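(* Let $f\colon X\rightharpoonup X$ be a partial map on a metric space $(X,d)$, let $a<b$ be non-negative integers, and let $F\colon D_F\rightharpoonup D_F$ be the restriction of the time extension of $f$ to $D_F\subseteq \{a,a+1,\dots,b\}\times X$, where $D_F$ is equipped with the cost function $c_d$ associated with $d$. Let $G,B \subset \{b \} \times X = D_{F} - \operatorname{dom}F$ be subsets with $G \sqcup B = \{b \} \times X$ (disjoint union). Then for any $\varepsilon \in [0,\infty)$, we have $G_{F,\varepsilon} \sqcup B_{F,-\varepsilon} = D_F$ (disjoint union), where for $\varepsilon=0$ the set $B_{F,-\varepsilon}$ means $B_{F,-0}$.
   Context: A partial map $f\colon X\rightharpoonup X$ is a map from a subset $\operatorname{dom}f\subseteq X$ to $X$. Time extension: put $Y:=\{a,a+1,\dots,b\}\times X$ and let $\widetilde f\colon Y\rightharpoonup Y$, $\widetilde f(t,x):=(t+1,f(x))$, be defined for $t\le b-1$ and $x\in\operatorname{dom}f$. Let $D_F:=\{(b-n,x)\in Y\mid n\in\{0,1,\dots,b-a\},\ f^n(x)\text{ is defined (i.e. } f^n(x)\in X)\}$ and let $F:=\widetilde f|_{D_F}\colon D_F\rightharpoonup D_F$. Then $\operatorname{dom}F=D_F-(\{b\}\times X)$, so $D_F-\operatorname{dom}F=\{b\}\times X$. Cost function associated with $d$: $c_d\colon D_F\times D_F\to[0,\infty]$, $c_d((t,x),(t',x')):=d(x,x')$ if $t=t'$ and $:=\infty$ if $t\ne t'$. Reachable sets (with $c=c_d$): for $\varepsilon\in[0,\infty]$ and $y\in D_F$,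 the set $[y]_F^{\varepsilon}$ consists of $y$ itself (path of length $0$) together with all points of the form $F(y_{n-1})$, where $n\ge 1$ and $(y_0,\dots,y_{n-1})\in(\operatorname{dom}F)^n$ satisfies $c(y,y_0)\le\varepsilon$ and $c(F(y_i),y_{i+1})\le\varepsilon$ for all $0\le i\le n-2$. Attracting basins of $A\subseteq D_F$: for $\varepsilon\in[0,\infty]$, $A_{F,\varepsilon}:=\{y\in D_F\mid [y]_F^{\varepsilon}\cap A\ne\emptyset\}$; $A_{F,-0}:=\{y\in D_F\mid \emptyset\ne[y]_F^{0}\setminus\operatorname{dom}F\subseteq A\}$; and for $\varepsilon\in(0,\infty]$, $A_{F,-\varepsilon}:=\{y\in A_{F,-0}\mid\emptyset\ne[y]_F^{\varepsilon}\setminus\operatorname{dom}F\subseteq A\}$. *)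

(* Defs.v *)
From HB Require Import structures.
From mathcomp Require Import all_boot all_order all_algebra.
From mathcomp Require Import all_classical all_reals all_analysis.

Set Implicit Arguments.
Unset Strict Implicit.
Unset Printing Implicit Defensive.

Import Order.TTheory GRing.Theory Num.Theory.

Local Open Scope classical_set_scope.
Local Open Scope ereal_scope.

(** A partial map [X -> X] is a function [X -> option X]; [None] means
    "undefined". *)

Definition pdom (X : Type) (f : X -> option X) : set X :=
  [set x | isSome (f x)].

Definition piter (X : Type) (f : X -> option X) (n : nat) (x : X) : option X :=
  iter n (obind f) (Some x).

Section Reachability.
Variables (R : realType) (D : Type).
Variables (F : D -> option D) (c : D -> D -> \bar R).
Implicit Types (e : \bar R) (y : D) (A : set D).

(** Only the values [u 0, ..., u (n-1)] and [v 0, ..., v (n-1)] matter;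
    [F (u i) = Some (v i)] says that [u i] is in the domain of [F] and that
    [v i] is its image. *)
Definition reach e y : set D :=
  [set z | z = y \/
    exists n : nat, exists u v : nat -> D,
      [/\ (0 < n)%N,
          forall i, (i < n)%N -> F (u i) = Some (v i),
          c y (u 0%N) <= e,
          forall i, (i.+1 < n)%N -> c (v i) (u i.+1) <= e &
          z = v n.-1]].

Definition basin e A : set D :=
  [set y | reach e y `&` A !=set0].

Definition basin_m0 A : set D :=
  [set y | reach 0 y `\` pdom F !=set0 /\ reach 0 y `\` pdom F `<=` A].

(** The basin of [A] with index [- e]; index [- 0] denotes [basin_m0]. *)
Definition basin_m e A : set D :=
  if e == 0 then basin_m0 A
  else [set y | [/\ basin_m0 A y,
                    reach e y `\` pdom F !=set0 &
                    reach e y `\` pdom F `<=` A]].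

End Reachability.

Section TimeExtension.
Variables (X : Type) (f : X -> option X) (a b : nat).

Definition timebox : set (nat * X) := [set p | (a <= p.1 <= b)%N].

Definition time_ext (p : nat * X) : option (nat * X) :=
  if (a <= p.1 < b)%N then omap (pair p.1.+1) (f p.2) else None.

Definition DF : set (nat * X) :=
  [set p | timebox p /\ exists n : nat,
    [/\ (n <= b - a)%N, p.1 = (b - n)%N & isSome (piter f n p.2)]].

(** The restriction of [time_ext] to a partial map on the subtype [DF]; [insub]
    never discards a value, see [val_Fmap]. *)
Definition Fmap (y : DF) : option DF :=
  obind insub (time_ext (val y)).

Definition final : set DF := [set y | (val y).1 = b].

Lemma piterS n x : piter f n.+1 x = obind (piter f n) (f x).
Proof.
rewrite /piter iterSr /=; case: (f x) => [z|] //=.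
by elim: n => //= n ->.
Qed.

Lemma time_ext_DF p q : DF p -> time_ext p = Some q -> DF q.
Proof.
case: p => t x [_ [n [/= nba tE fx]]].
rewrite /time_ext /=; case: ifP => // /andP[at_ tb].
case E: (f x) => [z|] //= [<-].
case: n => [|n] in nba tE fx *; first by rewrite tE subn0 ltnn in tb.
split; first by rewrite /timebox /= tb (leq_trans at_).
exists n; split => /=; first exact: ltnW.
- by rewrite tE subnSK // (leq_trans nba) ?leq_subr.
- by rewrite piterS E in fx.
Qed.

Lemma val_Fmap (y : DF) : omap val (Fmap y) = time_ext (val y).
Proof.
rewrite /Fmap; case E: (time_ext (val y)) => [q|] //=.
have qD : q \in DF by apply/mem_set/(time_ext_DF (set_mem (valP y)) E).
by rewrite insubT.
Qed.

Lemma DF_final x : (a < b)%N -> DF (b, x).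
Proof.
move=> ab; split; first by rewrite /timebox /= (ltnW ab) leqnn.
by exists 0%N; rewrite subn0.
Qed.

Lemma final_setC : final = ~` pdom Fmap.
Proof.
apply/seteqP; split=> y; rewrite /final /pdom /=.
  have := val_Fmap y; rewrite /time_ext => + yb.
  by rewrite yb ltnn andbF; case: (Fmap y).
have [tb [n [nba yE fy]]] := set_mem (valP y).
have := val_Fmap y; rewrite /time_ext; case: n => [|n] in nba yE fy *.
  by rewrite yE subn0.
have [y1 yb] := andP tb.
have nb : (n < b)%N by rewrite (leq_trans nba) ?leq_subr.
have -> : (a <= (val y).1 < b)%N.
  by rewrite y1 yE ltn_subrL (leq_trans _ nb).
rewrite piterS in fy; case: (f _) fy => [z|] //= _.
by case: (Fmap y) => // w _ /(_ isT).
Qed.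

End TimeExtension.

Arguments Fmap {X} f a b y.
Arguments final {X} f a b.

Definition cost (R : realType) (X : metricType R) (f : X -> option X)
    (a b : nat) (y y' : DF f a b) : \bar R :=
  if (val y).1 == (val y').1 then (mdist (val y).2 (val y').2)%:E else +oo.
Arguments cost {R X} f a b y y'.

(* Main.v *)
Require Import Defs.
From mathcomp Require Import all_boot all_order all_algebra.
From mathcomp Require Import all_classical all_reals all_analysis.

Import Order.TTheory.

Local Open Scope classical_set_scope.
Local Open Scope ring_scope.

(** Every point of [DF] flows exactly, in at most [b - a] steps, to the final
    slice, so the nonemptiness conditions in the negative basins always hold.
    As reachable sets grow with [e], [y] lies in the [- e] basin of [B] iff all
    the final points [e]-reachable from [y] are in [B], that is, iff none of
    them is in [G]. *)

Section Reach.
Variables (R : realType) (D : Type) (F : D -> option D) (c : D -> D -> \bar R).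

Lemma sub_reach (e e' : \bar R) (y : D) :
  (e <= e')%E -> reach F c e y `<=` reach F c e' y.
Proof.
move=> ee' z [->|[n [u [v [n0 Fu cy cu ->]]]]]; first by left.
right; exists n, u, v; split=> //; first exact: le_trans cy ee'.
by move=> i ni; exact: le_trans (cu i ni) ee'.
Qed.

(** Prepending [y] to a path from [y'] makes the new path begin with a jump from [y] to itself,
    whence the bound on [c y y]. The former initial jump out of [y'] becomes the jump after the
    first application of [F]. *)
Lemma reach_step (e : \bar R) (y y' : D) :
  (c y y <= e)%E -> F y = Some y' -> reach F c e y' `<=` reach F c e y.
Proof.
move=> cyy Fy z [->|[n [u [v [n0 Fu cy cu ->]]]]]; right.
  by exists 1%N, (fun=> y), (fun=> y'); split.
exists n.+1, (fun i => if i is j.+1 then u j else y),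
  (fun i => if i is j.+1 then v j else y'); split=> //.
- by case=> // i; exact: Fu.
- by case=> // i; exact: cu.
(* The endpoint now sits at index [n]; as [n] is positive, this is the shift of index [n.-1]. *)
- by case: n n0 {Fu cu}.
Qed.

Lemma basin_mE (e : \bar R) (A : set D) (y : D) : (0 <= e)%E ->
  reach F c 0 y `\` pdom F !=set0 ->
  basin_m F c e A y <-> reach F c e y `\` pdom F `<=` A.
Proof.
move=> e0 y0; rewrite /basin_m.
have sub0e : reach F c 0 y `\` pdom F `<=` reach F c e y `\` pdom F.
  by apply: setSD; apply: sub_reach.
case: eqP => [->|_]; first by split=> [[]|].
(* [sub0e] carries nonemptiness up from [0] to [e], and inclusion in [A] down from [e] to [0]. *)
split=> [[]//|yA]; split=> //; last exact: subset_nonempty y0.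
by split=> //; exact: subset_trans yA.
Qed.

End Reach.

Lemma costxx (R : realType) (X : metricType R) (f : X -> option X) (a b : nat)
  (y : DF f a b) : cost f a b y y = 0%E.
Proof. by rewrite /cost eqxx mdistxx. Qed.

Lemma Fmap_time (X : Type) (f : X -> option X) (a b : nat) (y z : DF f a b) :
  Fmap f a b y = Some z -> (val z).1 = (val y).1.+1.
Proof.
move=> yz; have := val_Fmap y; rewrite yz /time_ext /=.
by case: ifP => // _; case: (f _) => //= x [->].
Qed.

(** Induction on the remaining time: where [Fmap] is undefined, the path of length 0 suffices;
    elsewhere [reach_step] prepends one free step. *)
Lemma reach0_final (R : realType) (X : metricType R) (f : X -> option X)
    (a b : nat) (y : DF f a b) :
  reach (Fmap f a b) (cost f a b) 0 y `\` pdom (Fmap f a b) !=set0.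
Proof.
have [k] := ubnP (b - (val y).1); elim: k y => // k IH y yk.
case Fy: (Fmap f a b y) => [z|]; last first.
  by exists y; split; [left | rewrite /pdom /= Fy].
have [[/andP[_ zb] _] zE] := (set_mem (valP z), Fmap_time _ _ _ _ _ _ Fy).
have /IH : (b - (val z).1 < k)%N.
  by apply: leq_trans (_ : b - (val y).1 <= k)%N; rewrite // zE ltn_sub2l// -zE.
apply: subset_nonempty; apply: setSD; apply: reach_step Fy.
by rewrite costxx.
Qed.

Theorem theorem3p3 (R : realType) (X : metricType R) (f : X -> option X)
    (a b : nat) (hab : (a < b)%N) (G B : set (DF f a b))
    (hG : G `<=` final f a b) (hB : B `<=` final f a b)
    (hGB : G `|` B = final f a b) (hdisj : G `&` B = set0)
    (e : R) (he : 0 <= e) :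
  basin (Fmap f a b) (cost f a b) e%:E G `|`
    basin_m (Fmap f a b) (cost f a b) e%:E B = [set: DF f a b] /\
  basin (Fmap f a b) (cost f a b) e%:E G `&`
    basin_m (Fmap f a b) (cost f a b) e%:E B = set0.
Proof.
have BE y := basin_mE _ _ _ _ e%:E B y he (reach0_final _ _ f a b y).
split.
  apply/seteqP; split=> // y _.
  have [|yG] := pselect (basin (Fmap f a b) (cost f a b) e%:E G y); first by left.
  right; apply/BE => z [yz nz]; have : final f a b z by rewrite final_setC.
  by rewrite -hGB => -[zG|//]; case: yG; exists z.
apply/seteqP; split=> // y [[z [yz zG]] /BE yB].
suff: (G `&` B) z by rewrite hdisj.
(* A point of [G] is final, hence outside the domain of [Fmap], so [yB] applies to it. *)
by split=> //; apply: yB; split=> //; have := hG _ zG; rewrite final_setC.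
Qed.
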